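(* Let $k$ be a field, let $H$ be a Hopf algebra over $k$, and let $B\subseteq A$ be a Hopf-Galois extension by $H$ such that $A$ is a faithfully flat left $B$-module. Let $(\Omega^1(A),d)$ be a covariant first order differential calculus on $A$ for which there exists a right $H$-colinear, right $A$-linear and left $B$-linear map $\Pi:\Omega^1(A)\to\Omega^1(B)\otimes_BA$ such that $\Pi\circ j=\mathrm{id}$, where $j:\Omega^1(B)\otimes_BA\to\Omega^1(A)$, $\omega\otimes_Ba\mapsto\omega a$. Let $M$ be an $(A,H)$-Hopf module. Then any hom-connection $(M,\nabla)$ with respect to $\Omega^1(A)$ such that $$\nabla\left(\mathrm{Hom}^H_A(\Omega^1(A),M)\right)\subseteq M^{coH}$$ induces a hom-connection $(M^{coH},\nabla^{coH})$ with respect to $\Omega^1(B)$.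
   Context: Let $A$ be a right $H$-comodule algebra with coaction $\varrho^A:A\to A\otimes H$, $a\mapsto a_{(0)}\otimes a_{(1)}$ (an algebra map), and $B=A^{coH}=\{b\in A:\varrho^A(b)=b\otimes1\}$. $B\subseteq A$ is a Hopf-Galois extension if $A\otimes_BA\to A\otimes H$, $a\otimes_Ba'\mapsto a\varrho^A(a')$, is bijective. An $(A,H)$-Hopf module is a right $A$-module and right $H$-comodule $M$ with coaction $\varrho^M(m)=m_{(0)}\otimes m_{(1)}$ such that $\varrho^M(ma)=m_{(0)}a_{(0)}\otimes m_{(1)}a_{(1)}$; $\mathbf{M}^H_A$ is the category of these, with $\mathrm{Hom}^H_A$ denoting right $A$-linear right $H$-colinear maps. $M^{coH}=\{m\in M:\varrho^M(m)=m\otimes1\}$ is a right $B$-module. For a right $B$-module $N$, $N\otimes_BA$ is an $(A,H)$-Hopf module with $(n\otimes_Ba)a'=n\otimes_Baa'$ and coaction $n\otimes_Ba\mapsto n\otimes_B\varrho^A(a)$. A first order differential calculus on $A$ is an $A$-bimodule $\Omega^1(A)$ with a derivation $d:A\to\Omega^1(A)$. It is covariant if $\Omega^1(A)$ is an object of $\mathbf{M}_A^H$ and $d$ is right $H$-colinear; its left $B$-action is taken to be right $A$-linear and right $H$-colinear. $(\Omega^1(B),d)$ is the first order calculus on $B$ contained in $(\Omega^1(A),d)$, with $d$ obtained by restriction, i.e. the $B$-sub-bimodule of $\Omega^1(A)$ generated by $d(B)$. A hom-connection on a right $A$-module $M$ with respect to $\Omega^1(A)$ is a $k$-linear map $\nabla:\mathrm{Hom}_A(\Omega^1(A),M)\to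 M$ ($\mathrm{Hom}_A$ = right $A$-linear maps) with $\nabla(fa)=\nabla(f)a+f(da)$, where $(fa)(\omega)=f(a\omega)$; similarly for $B$ in place of $A$. The induced map is $\nabla^{coH}:\mathrm{Hom}_B(\Omega^1(B),M^{coH})\to M^{coH}$, $\nabla^{coH}(f)=\nabla(\widehat f\circ\Pi)$, where $\widehat f:\Omega^1(B)\otimes_BA\to M$, $\widehat f(\omega\otimes_Ba)=f(\omega)a$. *)

(* Defs.v *)
From HB Require Import structures.
From mathcomp Require Import all_boot all_order all_algebra.
From mathcomp Require Import boolp functions.

Set Implicit Arguments.
Unset Strict Implicit.
Unset Printing Implicit Defensive.

Import GRing.Theory.
Local Open Scope ring_scope.
Local Open Scope quotient_scope.

(* A module over a k-algebra R is a k-vector space with a k-bilinear action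
of R; bimodules are thus symmetric over k. *)

Section Actions.
Context {k : fieldType} (R : algType k) (M : lmodType k).

Definition is_right_action (act : M -> R -> M) : Prop :=
  [/\ forall r, linear (act^~ r), forall m, linear (act m),
      forall m r s, act m (r * s) = act (act m r) s & forall m, act m 1 = m].

Definition is_left_action (act : R -> M -> M) : Prop :=
  [/\ forall r, linear (act r), forall m, linear (act^~ m),
      forall r s m, act (r * s) m = act r (act s m) & forall m, act 1 m = m].

End Actions.

Record rmodule (k : fieldType) (R : algType k) := RModule {
  rmod_sort :> lmodType k;
  ract : rmod_sort -> R -> rmod_sort;
  ractP : is_right_action ract }.

Record lmodule (k : fieldType) (R : algType k) := LModule {
  lmod_sort :> lmodType k;
  lact : R -> lmod_sort -> lmod_sort;
  lactP : is_left_action lact }.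

Record bimodule (k : fieldType) (R : algType k) := Bimodule {
  bimod_r :> rmodule R;
  bact : R -> bimod_r -> bimod_r;
  bactP : is_left_action bact;
  bactA : forall r m s, ract (bact r m) s = bact r (ract m s) }.

Notation "m <@ r" := (ract m r) (at level 40, left associativity).
Notation "r @> m" := (bact r m) (at level 40, left associativity).

Section ActionTheory.
Context {k : fieldType} {R : algType k}.

Definition ractr (M : rmodule R) (r : R) : M -> M := fun m => m <@ r.
Fact ractr_linear (M : rmodule R) r : linear (@ractr M r).
Proof. by case: (ractP M) => + _ _ _; apply. Qed.
HB.instance Definition _ (M : rmodule R) r :=
  GRing.isLinear.Build k M M *:%R (@ractr M r) (ractr_linear r).

Fact ract_linear (M : rmodule R) (m : M) : linear (ract m).
Proof. by case: (ractP M) => _ + _ _; apply. Qed.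
HB.instance Definition _ (M : rmodule R) (m : M) :=
  GRing.isLinear.Build k R M *:%R (ract m) (ract_linear m).

Lemma ractM (M : rmodule R) (m : M) r s : m <@ (r * s) = m <@ r <@ s.
Proof. by case: (ractP M). Qed.
Lemma ract1 (M : rmodule R) (m : M) : m <@ 1 = m.
Proof. by case: (ractP M). Qed.
Lemma ractDl (M : rmodule R) (m n : M) r : (m + n) <@ r = m <@ r + n <@ r.
Proof. exact: (raddfD (ractr r)). Qed.
Lemma ractZl (M : rmodule R) c (m : M) r : (c *: m) <@ r = c *: (m <@ r).
Proof. exact: (linearZZ (ractr r)). Qed.
Lemma ract0l (M : rmodule R) r : (0 : M) <@ r = 0.
Proof. exact: (raddf0 (ractr r)). Qed.

Definition bactl (M : bimodule R) (r : R) : M -> M := bact r.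
Fact bactl_linear (M : bimodule R) r : linear (@bactl M r).
Proof. by case: (bactP M) => + _ _ _; apply. Qed.
HB.instance Definition _ (M : bimodule R) r :=
  GRing.isLinear.Build k M M *:%R (@bactl M r) (bactl_linear r).

Lemma bactDr (M : bimodule R) r (m n : M) : r @> (m + n) = r @> m + r @> n.
Proof. exact: (raddfD (bactl r)). Qed.
Lemma bactZr (M : bimodule R) r c (m : M) : r @> (c *: m) = c *: (r @> m).
Proof. exact: (linearZZ (bactl r)). Qed.
Lemma bactDl (M : bimodule R) r s (m : M) : (r + s) @> m = r @> m + s @> m.
Proof.
by case: (bactP M) => _ /(_ m 1 r s) h _ _; move: h; rewrite /= !scale1r.
Qed.
Lemma bactZl (M : bimodule R) c r (m : M) : (c *: r) @> m = c *: (r @> m).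
Proof.
case: (bactP M) => _ h _ _.
have h0 : (0 : R) @> m = 0.
  by move: (h m (-1) 0 0); rewrite /= !scaleN1r oppr0 addr0 addNr.
by move: (h m c r 0); rewrite /= h0 !addr0.
Qed.
Lemma bactM (M : bimodule R) r s (m : M) : (r * s) @> m = r @> (s @> m).
Proof. by case: (bactP M). Qed.
Lemma bact1 (M : bimodule R) (m : M) : 1 @> m = m.
Proof. by case: (bactP M). Qed.

End ActionTheory.

Section BasicModules.
Context {k : fieldType}.

Fact rspace_subproof (V : lmodType k) :
  @is_right_action k k^o V (fun v c => c *: v).
Proof.
split=> [c|v|v c d|v].
- by move=> a u v; rewrite scalerDr !scalerA mulrC.
- by move=> a c d; rewrite scalerDl -scalerA.
- by rewrite scalerA mulrC.
- exact: scale1r.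
Qed.
Definition rspace (V : lmodType k) : rmodule k^o :=
  RModule (rspace_subproof V).

Fact lspace_subproof (V : lmodType k) :
  @is_left_action k k^o V (fun c v => c *: v).
Proof.
split=> [c|v|c d v|v].
- by move=> a u v; rewrite scalerDr !scalerA mulrC.
- by move=> a c d; rewrite scalerDl -scalerA.
- by rewrite scalerA.
- exact: scale1r.
Qed.
Definition lspace (V : lmodType k) : lmodule k^o :=
  LModule (lspace_subproof V).

Fact rregular_subproof (R : algType k) : is_right_action (@GRing.mul R).
Proof.
split=> [r|m|m r s|m]; rewrite ?mulrA ?mulr1 //.
- by move=> a u v; rewrite mulrDl scalerAl.
- by move=> a u v; rewrite mulrDr scalerAr.
Qed.
Definition rregular (R : algType k) : rmodule R :=
  RModule (rregular_subproof R).

End BasicModules.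

Section RHom.
Context {k : fieldType} {R : algType k}.

Section Def.
Variables M N : rmodule R.

Definition right_linear : {pred M -> N} :=
  fun f => `[< linear f /\ forall m r, f (m <@ r) = f m <@ r >].

Lemma right_linearP f :
  reflect (linear f /\ forall m r, f (m <@ r) = f m <@ r)
          (f \in right_linear).
Proof. exact: asboolP. Qed.

Fact right_linear_closed : submod_closed right_linear.
Proof.
split=> [|c f g /right_linearP[fl fr] /right_linearP[gl gr]].
  by apply/right_linearP; split=> [a u v|m r] /=;
    rewrite ?scaler0 ?addr0 ?ract0l.
apply/right_linearP; split=> [a u v|m r].
  rewrite !fctE fl gl !scalerDr !scalerA [c * a]mulrC -!addrA.
  by congr (_ + _); rewrite addrCA.
by rewrite !fctE fr gr ractDl ractZl.
Qed.

Record rhom := RHom { rhom_fun :> M -> N; rhomP : rhom_fun \in right_linear }.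

HB.instance Definition _ := [isSub for rhom_fun].
HB.instance Definition _ := [Choice of rhom by <:].
HB.instance Definition _ :=
  GRing.SubChoice_isSubLmodule.Build k (M -> N) right_linear rhom
    right_linear_closed.

Fact rhom_linear (f : rhom) : linear f.
Proof. by case/right_linearP: (rhomP f). Qed.
HB.instance Definition _ (f : rhom) :=
  GRing.isLinear.Build k M N *:%R f (rhom_linear f).
Lemma rhom_ract (f : rhom) m r : f (m <@ r) = f m <@ r.
Proof. by case/right_linearP: (rhomP f). Qed.

End Def.

Arguments right_linear : clear implicits.

Fact rcomp_subproof (M N P : rmodule R) (g : rhom N P) (f : rhom M N) :
  g \o f \in right_linear M P.
Proof.
apply/right_linearP; split=> [a u v|m r] /=; first by rewrite !linearP.
by rewrite !rhom_ract.
Qed.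
Definition rcomp (M N P : rmodule R) (g : rhom N P) (f : rhom M N) : rhom M P :=
  RHom (rcomp_subproof g f).

Fact hom_act_subproof (W : bimodule R) (M : rmodule R) (f : rhom W M) (a : R) :
  (fun w => f (a @> w)) \in right_linear W M.
Proof.
apply/right_linearP; split=> [c u v|m r] /=.
  by rewrite bactDr bactZr linearP.
by rewrite -bactA rhom_ract.
Qed.
(* (f a)(w) = f (a w) *)
Definition hom_act (W : bimodule R) (M : rmodule R) (f : rhom W M) (a : R) :
  rhom W M := RHom (hom_act_subproof f a).

End RHom.

Arguments right_linear {k R} M N _.

(* M (x)_R N is the set of formal sums of pairs in M * N, modulo the congruence
generated by additivity in both arguments and (m r, n) ~ (m, r n). *)

Inductive tensor_eqv (k : fieldType) (R : algType k) (M : rmodule R)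
    (N : lmodule R) : seq (M * N) -> seq (M * N) -> Prop :=
| Teqv_refl s : tensor_eqv s s
| Teqv_sym s t : tensor_eqv s t -> tensor_eqv t s
| Teqv_trans s t u : tensor_eqv s t -> tensor_eqv t u -> tensor_eqv s u
| Teqv_cat s s' t t' :
    tensor_eqv s s' -> tensor_eqv t t' -> tensor_eqv (s ++ t) (s' ++ t')
| Teqv_catC s t : tensor_eqv (s ++ t) (t ++ s)
| Teqv_0 n : tensor_eqv [:: (0, n)] [::]
| Teqv_addl m m' n : tensor_eqv [:: (m + m', n)] [:: (m, n); (m', n)]
| Teqv_addr m n n' : tensor_eqv [:: (m, n + n')] [:: (m, n); (m, n')]
| Teqv_bal m r n : tensor_eqv [:: (m <@ r, n)] [:: (m, lact r n)].

Section Tensor.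
Context {k : fieldType} {R : algType k} (M : rmodule R) (N : lmodule R).
Local Notation E := (@tensor_eqv k R M N).

Definition tensor_eqvb (s t : seq (M * N)) : bool := `[< E s t >].

Fact tensor_eqvb_refl : reflexive tensor_eqvb.
Proof. by move=> s; apply/asboolP; constructor. Qed.
Fact tensor_eqvb_sym : symmetric tensor_eqvb.
Proof. by move=> s t; apply: asbool_equiv_eq; split; apply: Teqv_sym. Qed.
Fact tensor_eqvb_trans : transitive tensor_eqvb.
Proof.
move=> t s u /asboolP st /asboolP tu; apply/asboolP; exact: Teqv_trans tu.
Qed.
Canonical tensor_equiv :=
  EquivRel tensor_eqvb tensor_eqvb_refl tensor_eqvb_sym tensor_eqvb_trans.

Definition tensor := {eq_quot tensor_eqvb}.
HB.instance Definition _ := Choice.on tensor.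
HB.instance Definition _ := EqQuotient.on tensor.

Definition tclass (s : seq (M * N)) : tensor := \pi_tensor s.
Definition tpure (m : M) (n : N) : tensor := tclass [:: (m, n)].

Lemma tclassP s t : tclass s = tclass t <-> E s t.
Proof.
split=> [/eqmodP|st]; first by move/asboolP.
by apply/eqmodP/asboolP.
Qed.
Lemma tclassK (x : tensor) : tclass (repr x) = x.
Proof. exact: reprK. Qed.
Lemma repr_eqv s : E (repr (tclass s)) s.
Proof. by apply/tclassP; rewrite tclassK. Qed.

Definition tscale_seq (c : k) (s : seq (M * N)) :=
  [seq (c *: p.1, p.2) | p <- s].
Lemma tscale_eqv c s t : E s t -> E (tscale_seq c s) (tscale_seq c t).
Proof.
elim=> {s t}.
- by move=> s; constructor.
- by move=> s t _; exact: Teqv_sym.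
- by move=> s t u _ h _; exact: Teqv_trans.
- by move=> s s' t t' _ h _ h'; rewrite /tscale_seq !map_cat; exact: Teqv_cat.
- by move=> s t; rewrite /tscale_seq !map_cat; exact: Teqv_catC.
- by move=> n /=; rewrite /tscale_seq /= scaler0; exact: Teqv_0.
- by move=> m m' n; rewrite /tscale_seq /= scalerDr; exact: Teqv_addl.
- by move=> m n n'; exact: Teqv_addr.
- by move=> m r n; rewrite /tscale_seq /= -ractZl; exact: Teqv_bal.
Qed.

Definition tadd (x y : tensor) : tensor := tclass (repr x ++ repr y).
Definition tscale (c : k) (x : tensor) : tensor :=
  tclass (tscale_seq c (repr x)).

Lemma tadd_class s t : tadd (tclass s) (tclass t) = tclass (s ++ t).
Proof. by apply/tclassP; apply: Teqv_cat; exact: repr_eqv. Qed.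
Lemma tscale_class c s : tscale c (tclass s) = tclass (tscale_seq c s).
Proof. by apply/tclassP; apply: tscale_eqv; exact: repr_eqv. Qed.

Lemma tclass_cons m n s : tclass ((m, n) :: s) = tadd (tpure m n) (tclass s).
Proof. by rewrite tadd_class. Qed.

Fact taddC : commutative tadd.
Proof.
move=> x y; rewrite -(tclassK x) -(tclassK y) !tadd_class.
by apply/tclassP; exact: Teqv_catC.
Qed.
Fact taddA : associative tadd.
Proof.
move=> x y z; rewrite -(tclassK x) -(tclassK y) -(tclassK z) !tadd_class.
by rewrite catA.
Qed.
Fact tadd0 : left_id (tclass [::]) tadd.
Proof. by move=> x; rewrite -(tclassK x) tadd_class. Qed.

Lemma tensor_seq_ind (P : tensor -> Prop) :
  P (tclass [::]) -> (forall m n x, P x -> P (tadd (tpure m n) x)) ->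
  forall x, P x.
Proof.
move=> P0 PD x; rewrite -(tclassK x); elim: (repr x) => // -[m n] s IH.
by rewrite tclass_cons; exact: PD.
Qed.

Lemma tscale_pure c m n : tscale c (tpure m n) = tpure (c *: m) n.
Proof. by rewrite tscale_class. Qed.
Lemma tscaleD c : {morph tscale c : x y / tadd x y}.
Proof.
move=> x y; rewrite -(tclassK x) -(tclassK y).
by rewrite !(tadd_class, tscale_class) /tscale_seq map_cat.
Qed.
Lemma tpure0l n : tpure 0 n = tclass [::].
Proof. by apply/tclassP; exact: Teqv_0. Qed.
Lemma tpure_addl m m' n : tpure (m + m') n = tadd (tpure m n) (tpure m' n).
Proof. by rewrite tadd_class; apply/tclassP; exact: Teqv_addl. Qed.
Lemma tscale_nil c : tscale c (tclass [::]) = tclass [::].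
Proof. by rewrite tscale_class. Qed.

Fact tscale1 : left_id 1 tscale.
Proof.
move=> x; rewrite -(tclassK x) tscale_class; congr tclass.
by rewrite /tscale_seq map_id_in // => -[m n] _ /=; rewrite scale1r.
Qed.
Fact tscaleA a b x : tscale a (tscale b x) = tscale (a * b) x.
Proof.
rewrite -(tclassK x) !tscale_class; congr tclass.
by rewrite /tscale_seq -map_comp; apply: eq_map => -[m n] /=; rewrite scalerA.
Qed.
Fact tscaleDl x : {morph tscale^~ x : a b / a + b >-> tadd a b}.
Proof.
move=> a b /=; elim/tensor_seq_ind: x => [|m n x IH].
  by rewrite !tscale_nil tadd0.
rewrite !tscaleD IH !tscale_pure scalerDl tpure_addl -!taddA; congr tadd.
by rewrite !taddA; congr tadd; rewrite taddC.
Qed.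
Fact taddN : left_inverse (tclass [::]) (tscale (-1)) tadd.
Proof.
elim/tensor_seq_ind=> [|m n x IH]; first by rewrite tscale_nil tadd0.
rewrite tscaleD -taddA [tadd _ (tadd (tpure m n) x)]taddA.
rewrite [tadd _ (tpure m n)]taddC -[tadd (tadd _ _) x]taddA IH.
by rewrite taddA tscale_pure -tpure_addl scaleN1r addNr tpure0l tadd0.
Qed.

HB.instance Definition _ :=
  GRing.isZmodule.Build tensor taddA taddC tadd0 taddN.
HB.instance Definition _ :=
  GRing.Zmodule_isLmodule.Build k tensor tscaleA tscale1 tscaleD tscaleDl.

Lemma tensor_ind (P : tensor -> Prop) :
  P 0 -> (forall m n x, P x -> P (tpure m n + x)) -> forall x, P x.
Proof. exact: tensor_seq_ind. Qed.

Lemma tpureDl m m' n : tpure (m + m') n = tpure m n + tpure m' n.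
Proof. exact: tpure_addl. Qed.
Lemma tpureDr m n n' : tpure m (n + n') = tpure m n + tpure m n'.
Proof.
by rewrite [RHS]tadd_class; apply/tclassP; exact: Teqv_addr.
Qed.
Lemma tpure_bal m r n : tpure (m <@ r) n = tpure m (lact r n).
Proof. by apply/tclassP; exact: Teqv_bal. Qed.
Lemma tpureZl c m n : tpure (c *: m) n = c *: tpure m n.
Proof. by rewrite [RHS]tscale_pure. Qed.
Lemma tpureZr c m n : tpure m (c *: n) = c *: tpure m n.
Proof.
have -> : c *: n = lact c%:A n.
  case: (lactP N) => [_ h _ h1]; rewrite -{1}(h1 n).
  have h0 : lact 0 n = 0.
    by move: (h n (-1) 0 0); rewrite /= !scaleN1r oppr0 addr0 addNr.
  by move: (h n c 1 0); rewrite /= h0 !addr0.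
by rewrite -tpure_bal linearZ /= ract1 tpureZl.
Qed.

Section Lift.
Variable V : lmodType k.

Definition balanced (f : M -> N -> V) : Prop :=
  [/\ forall n, linear (f^~ n), forall m, linear (f m)
    & forall m r n, f (m <@ r) n = f m (lact r n)].

Variables (f : M -> N -> V) (fP : balanced f).

(* The linear map with tpure m n |-> f m n, see tliftE; the argument fP makes
   it independent of the chosen representative. *)
Definition tlift of balanced f := fun x : tensor =>
  \sum_(p <- repr x) f p.1 p.2.

Lemma tlift_class s : tlift fP (tclass s) = \sum_(p <- s) f p.1 p.2.
Proof.
case: fP => fl fr fb.
have fDl m m' n : f (m + m') n = f m n + f m' n.
  by have /= := fl n 1 m m'; rewrite !scale1r.
have fDr m n n' : f m (n + n') = f m n + f m n'.
  by have /= := fr m 1 n n'; rewrite !scale1r.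
have fE s1 s2 : E s1 s2 ->
  \sum_(p <- s1) f p.1 p.2 = \sum_(p <- s2) f p.1 p.2; last first.
  exact/fE/repr_eqv.
move=> {s}; elim=> {s1 s2} //=.
- by move=> s t u _ -> _ ->.
- by move=> s s' t t' _ h _ h'; rewrite !big_cat /= h h'.
- by move=> s t; rewrite !big_cat /= addrC.
- move=> n; rewrite big_seq1 big_nil /=.
  by apply: (addrI (f 0 n)); rewrite addr0 -fDl addr0.
- by move=> m m' n; rewrite big_seq1 big_cons big_seq1 /= fDl.
- by move=> m n n'; rewrite big_seq1 big_cons big_seq1 /= fDr.
- by move=> m r n; rewrite !big_seq1 /= fb.
Qed.

Lemma tliftE m n : tlift fP (tpure m n) = f m n.
Proof. by rewrite tlift_class big_seq1. Qed.

Fact tlift_linear : linear (tlift fP).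
Proof.
move=> c x y; rewrite -(tclassK x) -(tclassK y).
have -> : c *: tclass (repr x) + tclass (repr y) =
          tclass (tscale_seq c (repr x) ++ repr y).
  by rewrite -tadd_class -tscale_class.
rewrite !tlift_class big_cat big_map scaler_sumr /=; congr (_ + _).
apply: eq_bigr => -[m n] _ /=; case: fP => fl _ _.
have f0 : f 0 n = 0.
  by have /= := fl n (-1) 0 0; rewrite !scaleN1r oppr0 addr0 addNr.
by have /= := fl n c m 0; rewrite f0 !addr0.
Qed.
HB.instance Definition _ :=
  GRing.isLinear.Build k tensor V *:%R (tlift fP) tlift_linear.

End Lift.
End Tensor.

Arguments tensor_ind : clear implicits.
Arguments tpure {k R M N} m n.
Arguments tlift {k R M N V f} fP x.

Notation "U \ox V" := (tensor (rspace U) (lspace V))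
  (at level 40, left associativity) : type_scope.
Notation "u *t v" := (@tpure _ _ (rspace _) (lspace _) u v)
  (at level 40, left associativity) : ring_scope.

Section TensorMaps.
Context {k : fieldType}.

Section Pure.
Context {R : algType k} {M : rmodule R} {N : lmodule R}.

Definition tpurer (n : N) : M -> tensor M N := fun m => tpure m n.
Fact tpurer_linear n : linear (tpurer n).
Proof. by move=> c u v; rewrite /tpurer tpureDl tpureZl. Qed.
HB.instance Definition _ n :=
  GRing.isLinear.Build k M (tensor M N) *:%R (tpurer n) (tpurer_linear n).

Fact tpure_linear (m : M) : linear (@tpure _ _ M N m).
Proof. by move=> c u v; rewrite tpureDr tpureZr. Qed.
HB.instance Definition _ (m : M) :=
  GRing.isLinear.Build k N (tensor M N) *:%R (tpure m) (tpure_linear m).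

Lemma tensor_ext (V : lmodType k) (f g : tensor M N -> V) :
  linear f -> linear g -> (forall m n, f (tpure m n) = g (tpure m n)) ->
  f =1 g.
Proof.
move=> fl gl fg; have h0 (h : tensor M N -> V) : linear h -> h 0 = 0.
  by move=> hl; have := hl (-1) 0 0; rewrite !scaleN1r oppr0 addr0 addNr.
move=> x; elim/tensor_ind: x => [|m n x IH]; first by rewrite !h0.
have fD := fl 1 (tpure m n) x; have gD := gl 1 (tpure m n) x.
by rewrite !scale1r in fD gD; rewrite fD gD IH fg.
Qed.

End Pure.

Lemma bilinear_balanced (U V W : lmodType k) (f : U -> V -> W) :
  (forall v, linear (f^~ v)) -> (forall u, linear (f u)) ->
  @balanced k k^o (rspace U) (lspace V) W f.
Proof.
move=> fl fr; split=> // u c v /=.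
have f0l : f 0 v = 0.
  by have /= := fl v (-1) 0 0; rewrite !scaleN1r oppr0 addr0 addNr.
have f0r : f u 0 = 0.
  by have /= := fr u (-1) 0 0; rewrite !scaleN1r oppr0 addr0 addNr.
by move: (fl v c u 0) (fr u c v 0); rewrite /= f0l f0r !addr0 => -> ->.
Qed.

(* f (x) g over k *)
Section Tmap.
Variables (U V U' V' : lmodType k).
Variables (f : {linear U -> U'}) (g : {linear V -> V'}).
Fact tmap_subproof :
  @balanced k k^o (rspace U) (lspace V) (U' \ox V') (fun u v => f u *t g v).
Proof.
apply: bilinear_balanced => [v|u] c x y /=.
  by rewrite linearP tpureDl tpureZl.
by rewrite linearP tpureDr tpureZr.
Qed.
Definition tmap : U \ox V -> U' \ox V' := tlift tmap_subproof.
HB.instance Definition _ := GRing.Linear.copy tmap (tlift tmap_subproof).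
Lemma tmapE u v : tmap (u *t v) = f u *t g v.
Proof. exact: tliftE. Qed.
End Tmap.
Arguments tmap : simpl never.

(* (u (x) v) (x) w |-> u (x) (v (x) w) *)
Section Assoc.
Variables U V W : lmodType k.
Fact tassoc_subproof :
  @balanced k k^o (rspace (U \ox V)) (lspace W) (U \ox (V \ox W))
    (fun t w => tmap idfun (@tpurer _ (rspace V) (lspace W) w) t).
Proof.
apply: bilinear_balanced => [w|t] c x y /=; first by rewrite linearP.
elim/tensor_ind: t => [|u v t IH]; first by rewrite !linear0 ?scaler0 addr0.
rewrite !linearD /= IH !tmapE /= /tpurer !(tpureDr, tpureZr) ?scalerDr -!addrA.
by congr (_ + _); rewrite addrCA.
Qed.
Definition tassoc : (U \ox V) \ox W -> U \ox (V \ox W) := tlift tassoc_subproof.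
HB.instance Definition _ := GRing.Linear.copy tassoc (tlift tassoc_subproof).
Lemma tassocE u v w : tassoc ((u *t v) *t w) = u *t (v *t w).
Proof. by rewrite /tassoc /= tliftE tmapE. Qed.
End Assoc.
Arguments tassoc : simpl never.

(* f (x) id over R *)
Section Tmapl.
Context {R : algType k} (M M' : rmodule R) (N : lmodule R) (f : rhom M M').
Fact tmapl_subproof :
  @balanced k R M N (tensor M' N) (fun m n => tpure (f m) n).
Proof.
split=> [n c x y|m c x y|m r n] /=.
- by rewrite linearP tpureDl tpureZl.
- by rewrite tpureDr tpureZr.
- by rewrite rhom_ract tpure_bal.
Qed.
Definition tmapl : tensor M N -> tensor M' N := tlift tmapl_subproof.
HB.instance Definition _ := GRing.Linear.copy tmapl (tlift tmapl_subproof).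
Lemma tmaplE m n : tmapl (tpure m n) = tpure (f m) n.
Proof. exact: tliftE. Qed.
End Tmapl.
Arguments tmapl : simpl never.

(* v (x) h |-> e(h) v and h (x) v |-> e(h) v *)
Section Contract.
Variables (V W : lmodType k) (e : {linear W -> k^o}).
Fact tcontrr_subproof :
  @balanced k k^o (rspace V) (lspace W) V (fun v w => (e w : k) *: v).
Proof.
apply: bilinear_balanced => [w|v] c x y /=.
  by rewrite scalerDr !scalerA mulrC.
by rewrite linearP scalerDl -scalerA.
Qed.
Definition tcontrr : V \ox W -> V := tlift tcontrr_subproof.
HB.instance Definition _ := GRing.Linear.copy tcontrr (tlift tcontrr_subproof).
Lemma tcontrrE v w : tcontrr (v *t w) = (e w : k) *: v.
Proof. exact: tliftE. Qed.

Fact tcontrl_subproof :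
  @balanced k k^o (rspace W) (lspace V) V (fun w v => (e w : k) *: v).
Proof.
apply: bilinear_balanced => [v|w] c x y /=.
  by rewrite linearP scalerDl -scalerA.
by rewrite scalerDr !scalerA mulrC.
Qed.
Definition tcontrl : W \ox V -> V := tlift tcontrl_subproof.
HB.instance Definition _ := GRing.Linear.copy tcontrl (tlift tcontrl_subproof).
Lemma tcontrlE v w : tcontrl (w *t v) = (e w : k) *: v.
Proof. exact: tliftE. Qed.
End Contract.
Arguments tcontrl : simpl never.
Arguments tcontrr : simpl never.

Section Mult.
Variable R : algType k.
Fact tmult_subproof : @balanced k k^o (rspace R) (lspace R) R *%R.
Proof.
apply: bilinear_balanced => [v|u] c x y /=.
  by rewrite mulrDl scalerAl.
by rewrite mulrDr scalerAr.
Qed.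
Definition tmult : R \ox R -> R := tlift tmult_subproof.
HB.instance Definition _ := GRing.Linear.copy tmult (tlift tmult_subproof).
Lemma tmultE r s : tmult (r *t s) = r * s.
Proof. exact: tliftE. Qed.
End Mult.
Arguments tmult : simpl never.

Lemma tmap_tmap (U V U1 V1 U2 V2 : lmodType k)
    (f : {linear U -> U1}) (g : {linear V -> V1})
    (f' : {linear U1 -> U2}) (g' : {linear V1 -> V2}) x :
  tmap f' g' (tmap f g x) = tmap (f' \o f) (g' \o g) x.
Proof.
elim/tensor_ind: x => [|u v x IH]; first by rewrite !linear0.
by rewrite !linearD /= IH !tmapE.
Qed.

Lemma tassoc_tmap (U V W U1 : lmodType k) (f : {linear U -> U1})
    (x : (U \ox V) \ox W) :
  tassoc (tmap (tmap f idfun) idfun x) = tmap f idfun (tassoc x).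
Proof.
elim/tensor_ind: x => [|t w x IH]; first by rewrite !linear0.
rewrite !linearD /= IH; congr (_ + _) => {x IH}; rewrite tmapE /=.
elim/tensor_ind: t => [|u v t IH].
  have h0 (X : lmodType k) : (0 : X) *t w = 0.
    by rewrite -(scale0r 0) tpureZl scale0r.
  by rewrite linear0 !h0 !linear0.
rewrite linearD /= tpureDl linearD /= IH tmapE tassocE.
by rewrite [in RHS]tpureDl !linearD /= tassocE tmapE.
Qed.

Lemma tcontrr_tmap (V V1 W : lmodType k) (e : {linear W -> k^o})
    (f : {linear V -> V1}) (x : V \ox W) :
  tcontrr e (tmap f idfun x) = f (tcontrr e x).
Proof.
elim/tensor_ind: x => [|v w x IH]; first by rewrite !linear0.
by rewrite !linearD /= IH tmapE !tcontrrE linearZ.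
Qed.

End TensorMaps.

Section TensorAction.
Context {k : fieldType} {A H : algType k} (M : rmodule A) (N : rmodule H).

Fact tact_subproof (x : M \ox N) :
  @balanced k k^o (rspace A) (lspace H) (M \ox N)
    (fun a h => tmap (@ractr _ _ M a) (@ractr _ _ N h) x).
Proof.
apply: bilinear_balanced => [h|a] c u v /=.
all: elim/tensor_ind: x => [|m n x IH];
  first by rewrite !linear0 ?scaler0 addr0.
all: rewrite !linearD /= IH !tmapE /= /ractr linearP.
  rewrite tpureDl tpureZl ?scalerDr -!addrA.
  by congr (_ + _); rewrite addrCA.
rewrite tpureDr tpureZr ?scalerDr -!addrA.
by congr (_ + _); rewrite addrCA.
Qed.
(* tact (m (x) n) (a (x) h) = m a (x) n h, see tactE *)
Definition tact (x : M \ox N) : A \ox H -> M \ox N := tlift (tact_subproof x).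
HB.instance Definition _ (x : M \ox N) :=
  GRing.Linear.copy (tact x) (tlift (tact_subproof x)).

Lemma tact_pure x a h : tact x (a *t h) = tmap (ractr a) (ractr h) x.
Proof. exact: tliftE. Qed.
Lemma tactE (m : M) (n : N) (a : A) (h : H) :
  tact (m *t n) (a *t h) = (m <@ a) *t (n <@ h).
Proof. by rewrite tact_pure tmapE. Qed.
Lemma tact_linear (y : A \ox H) : linear (tact^~ y).
Proof.
move=> c u v /=; elim/tensor_ind: y => [|a h y IH].
  by rewrite !linear0 ?scaler0 addr0.
rewrite !linearD /= IH !tact_pure linearP ?scalerDr -!addrA.
by congr (_ + _); rewrite addrCA.
Qed.
Lemma tactDl u v (y : A \ox H) : tact (u + v) y = tact u y + tact v y.
Proof. by have /= := tact_linear y 1 u v; rewrite !scale1r. Qed.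
Lemma tact0l (y : A \ox H) : tact 0 y = 0.
Proof. by apply: (addrI (tact 0 y)); rewrite -tactDl !addr0. Qed.
End TensorAction.
Arguments tact : simpl never.

Lemma tact_tmap (k : fieldType) (A H : algType k) (M M1 : rmodule A)
    (N : rmodule H) (f : {linear M -> M1}) (x : M \ox N) (y : A \ox H) :
  (forall m a, f (m <@ a) = f m <@ a) ->
  tmap f idfun (tact x y) = tact (tmap f idfun x) y.
Proof.
move=> fA; elim/tensor_ind: y => [|a h y IHy]; first by rewrite !linear0.
rewrite !linearD /= IHy; congr (_ + _) => {y IHy}.
elim/tensor_ind: x => [|m n x IH]; first by rewrite linear0 !tact0l linear0.
by rewrite linearD !tactDl linearD /= IH !tmapE !tactE tmapE fA.
Qed.

Section TensorAlgebra.
Context {k : fieldType} (A H : algType k).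

Definition tmul (x y : A \ox H) : A \ox H :=
  @tact k A H (rregular A) (rregular H) x y.

Lemma tmulE (a : A) (h : H) (b : A) (g : H) :
  tmul (a *t h) (b *t g) = (a * b) *t (h * g).
Proof. exact: (@tactE _ _ _ (rregular A) (rregular H)). Qed.

Lemma tactM (M : rmodule A) (N : rmodule H) (x : M \ox N) (y z : A \ox H) :
  tact x (tmul y z) = tact (tact x y) z.
Proof.
elim/tensor_ind: z => [|b g z IHz]; first by rewrite /tmul !linear0.
rewrite /tmul !linearD /= -/(tmul y z) IHz -/(tmul _ _); congr (_ + _).
move=> {z IHz}.
elim/tensor_ind: y => [|a h y IHy].
  by rewrite /tmul tact0l !linear0 tact0l.
rewrite /tmul tactDl !linearD /= tactDl -IHy -/(tmul _ _); congr (_ + _).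
elim/tensor_ind: x {IHy} => [|m n x IHx]; first by rewrite !tact0l.
by rewrite !tactDl IHx /= tmulE !tactE !ractM.
Qed.

Fact tmulA : associative tmul.
Proof. by move=> x y z; exact: (@tactM (rregular A) (rregular H)). Qed.
Fact tmul1l : left_id (1 *t 1) tmul.
Proof.
move=> x; elim/tensor_ind: x => [|a h x IH]; first by rewrite /tmul linear0.
by rewrite /tmul linearD /= -!/(tmul _ _) IH tmulE !mul1r.
Qed.
Fact tmul1r : right_id (1 *t 1) tmul.
Proof.
move=> x; elim/tensor_ind: x => [|a h x IH]; first by rewrite /tmul tact0l.
by rewrite /tmul tactDl /= -!/(tmul _ _) IH tmulE !mulr1.
Qed.
Fact tmulDl : left_distributive tmul +%R.
Proof. by move=> x y z; rewrite /tmul tactDl. Qed.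
Fact tmulDr : right_distributive tmul +%R.
Proof. by move=> x y z; rewrite /tmul linearD. Qed.

HB.instance Definition _ := GRing.Zmodule_isPzRing.Build (A \ox H)
  tmulA tmul1l tmul1r tmulDl tmulDr.

End TensorAlgebra.

Record hopfAlgebra (k : fieldType) := HopfAlgebra {
  hopf_sort :> algType k;
  hopf_comul : {lrmorphism hopf_sort -> hopf_sort \ox hopf_sort};
  hopf_counit : {lrmorphism hopf_sort -> k^o};
  hopf_antipode : {linear hopf_sort -> hopf_sort};
  hopf_coassoc : forall h,
    tassoc (tmap hopf_comul idfun (hopf_comul h)) =
    tmap idfun hopf_comul (hopf_comul h);
  hopf_counitl : forall h, tcontrl hopf_counit (hopf_comul h) = h;
  hopf_counitr : forall h, tcontrr hopf_counit (hopf_comul h) = h;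
  hopf_antipodel : forall h,
    tmult (tmap hopf_antipode idfun (hopf_comul h)) =
    (hopf_counit h : k)%:A;
  hopf_antipoder : forall h,
    tmult (tmap idfun hopf_antipode (hopf_comul h)) =
    (hopf_counit h : k)%:A }.

Section Comodules.
Context {k : fieldType} (H : hopfAlgebra k).

Definition is_right_coaction (V : lmodType k) (rho : {linear V -> V \ox H}) :=
  (forall v, tassoc (tmap rho idfun (rho v)) =
             tmap idfun (hopf_comul H) (rho v)) /\
  (forall v, tcontrr (hopf_counit H) (rho v) = v).

Record comodAlgebra := ComodAlgebra {
  ca_sort :> algType k;
  ca_coact : {lrmorphism ca_sort -> ca_sort \ox H};
  ca_coactP : is_right_coaction ca_coact }.

Definition coinv (V : lmodType k) (rho : V -> V \ox H) : {pred V} :=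
  fun v => `[< rho v = v *t 1 >].

Lemma coinvP (V : lmodType k) (rho : V -> V \ox H) v :
  reflect (rho v = v *t 1) (v \in coinv rho).
Proof. exact: asboolP. Qed.

Lemma coinv_closed (V : lmodType k) (rho : {linear V -> V \ox H}) :
  submod_closed (coinv rho).
Proof.
split=> [|c u v /coinvP uP /coinvP vP]; apply/coinvP.
  by rewrite linear0 -[X in X *t _](scale0r 0) tpureZl scale0r.
by rewrite linearP /= uP vP tpureDl tpureZl.
Qed.

End Comodules.

Section Coinvariants.
Context {k : fieldType} {H : hopfAlgebra k} (A : comodAlgebra H).

(* B = A^coH *)
Record coinvAlg := CoinvAlg {
  ba_val :> A;
  ba_valP : ba_val \in coinv (ca_coact A) }.

Fact coinv_subalg_closed : subalg_closed (coinv (ca_coact A)).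
Proof.
split; first by apply/coinvP; exact: rmorph1.
  exact: (coinv_closed _).2.
move=> a b /coinvP aP /coinvP bP; apply/coinvP.
rewrite rmorphM /= aP bP; by apply: etrans (tmulE _ _ _ _) _; rewrite mulr1.
Qed.

HB.instance Definition _ := [isSub for ba_val].
HB.instance Definition _ := [Choice of coinvAlg by <:].
HB.instance Definition _ :=
  GRing.SubChoice_isSubAlgebra.Build k A _ coinvAlg coinv_subalg_closed.

End Coinvariants.

Section CoinvariantsTheory.
Context {k : fieldType} {H : hopfAlgebra k} {A : comodAlgebra H}.

Lemma ba_valD c (u v : coinvAlg A) :
  ba_val (c *: u + v) = c *: ba_val u + ba_val v.
Proof. by []. Qed.
Lemma ba_valM (u v : coinvAlg A) : ba_val (u * v) = ba_val u * ba_val v.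
Proof. by []. Qed.
Lemma ba_val1 : ba_val (1 : coinvAlg A) = 1.
Proof. by []. Qed.

End CoinvariantsTheory.

Section Restriction.
Context {k : fieldType} {H : hopfAlgebra k} (A : comodAlgebra H).
Local Notation B := (coinvAlg A).

Fact rmod_res_subproof (M : rmodule A) :
  @is_right_action k B M (fun m b => m <@ \val b).
Proof.
split=> [b|m|m b c|m] /=.
- exact: ractr_linear.
- by move=> c u v; rewrite ?ba_valD linearP.
- by rewrite ?ba_valM ractM.
- by rewrite ?ba_val1 ract1.
Qed.
Definition rmod_res (M : rmodule A) : rmodule B :=
  RModule (rmod_res_subproof M).

Fact coinv_lregular_subproof :
  @is_left_action k B A (fun b a => \val b * a).
Proof.
split=> [b|a|b c a|a] /=.
- by move=> c u v; rewrite mulrDr scalerAr.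
- by move=> c u v; rewrite ?ba_valD mulrDl scalerAl.
- by rewrite ?ba_valM mulrA.
- by rewrite ?ba_val1 mul1r.
Qed.
Definition coinv_lregular : lmodule B := LModule coinv_lregular_subproof.

End Restriction.

Definition exact_at (U V W : zmodType) (f : U -> V) (g : V -> W) : Prop :=
  forall v, g v = 0 <-> exists u, f u = v.

(* - (x)_R N preserves and reflects exactness *)
Definition faithfully_flat (k : fieldType) (R : algType k) (N : lmodule R) :=
  forall (M1 M2 M3 : rmodule R) (f : rhom M1 M2) (g : rhom M2 M3),
    exact_at f g <-> exact_at (@tmapl _ _ _ _ N f) (@tmapl _ _ _ _ N g).

Section HopfGalois.
Context {k : fieldType} {H : hopfAlgebra k} (A : comodAlgebra H).
Local Notation B := (coinvAlg A).

Fact hg_can_subproof :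
  @balanced k B (rmod_res (rregular A)) (coinv_lregular A) (A \ox H)
    (fun a a' => (a *t 1) * ca_coact A a').
Proof.
split=> [a'|a|a b a'] /=.
- by move=> c u v; rewrite tpureDl tpureZl;
  exact: (@tact_linear _ _ _ (rregular A) (rregular H)).
- by move=> c u v; rewrite linearP mulrDr; congr (_ + _);
  exact: (linearZZ (@tact _ _ _ (rregular A) (rregular H) _)).
- rewrite rmorphM /= mulrA; congr (_ * _).
  by case: b => b /= /coinvP ->; rewrite [RHS](tmulE a 1 b 1) mulr1.
Qed.
(* a (x)_B a' |-> a rho(a') *)
Definition hg_can :
  tensor (rmod_res (rregular A)) (coinv_lregular A) -> A \ox H :=
  tlift hg_can_subproof.

Definition hopf_galois : Prop := bijective hg_can.

End HopfGalois.

Section HopfModules.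
Context {k : fieldType} {H : hopfAlgebra k} (A : comodAlgebra H).
Local Notation B := (coinvAlg A).

Definition is_hopf_module (M : rmodule A) (rho : {linear M -> M \ox H}) :=
  is_right_coaction rho /\
  forall m a, rho (m <@ a) = @tact _ _ _ M (rregular H) (rho m) (ca_coact A a).

Record hopfModule := HopfModule {
  hm_sort :> rmodule A;
  hm_coact : {linear hm_sort -> hm_sort \ox H};
  hm_coactP : is_hopf_module hm_coact }.

Definition right_colinear (V W : lmodType k) (rhoV : V -> V \ox H)
    (rhoW : W -> W \ox H) (f : {linear V -> W}) : Prop :=
  forall v, rhoW (f v) = tmap f idfun (rhoV v).

(* M^coH *)
Section CoinvMod.
Variable M : hopfModule.

Record coinvMod_sort := CoinvMod {
  cm_val :> M;
  cm_valP : cm_val \in coinv (hm_coact M) }.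

HB.instance Definition _ := [isSub for cm_val].
HB.instance Definition _ := [Choice of coinvMod_sort by <:].
HB.instance Definition _ :=
  GRing.SubChoice_isSubLmodule.Build k M _ coinvMod_sort
    (coinv_closed (hm_coact M)).

Lemma cm_valD c (u v : coinvMod_sort) :
  cm_val (c *: u + v) = c *: cm_val u + cm_val v.
Proof. by []. Qed.

Fact coinvMod_act_subproof (m : coinvMod_sort) (b : B) :
  \val m <@ \val b \in coinv (hm_coact M).
Proof.
apply/coinvP; case: (hm_coactP M) => _ ->.
case: m b => m /= /coinvP -> [b /= /coinvP ->].
by rewrite (@tactE _ _ _ M (rregular H)) /= mulr1.
Qed.
Definition coinvMod_act m b : coinvMod_sort :=
  CoinvMod (coinvMod_act_subproof m b).

Fact coinvModP : is_right_action coinvMod_act.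
Proof.
split=> [b|m|m b c|m]; [move=> c u v|move=> c u v| |]; apply: val_inj => /=.
- by rewrite ?cm_valD ractDl ractZl.
- by rewrite ?ba_valD linearP.
- by rewrite ?ba_valM ractM.
- by rewrite ?ba_val1 ract1.
Qed.
Definition coinvMod : rmodule B := RModule coinvModP.
End CoinvMod.

(* N (x)_B A *)
Section Induced.
Variable N : rmodule B.

Definition ind_sort : lmodType k := tensor N (coinv_lregular A).

(* ind_in n a = n (x)_B a *)
Definition ind_in (n : N) (a : A) : ind_sort :=
  @tpure _ _ N (coinv_lregular A) n a.
Fact ind_in_linear n : linear (ind_in n).
Proof. exact: (@tpure_linear _ _ N (coinv_lregular A)). Qed.
HB.instance Definition _ n :=
  GRing.isLinear.Build k A ind_sort *:%R (ind_in n) (ind_in_linear n).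
Lemma ind_in_linearl a : linear (ind_in^~ a).
Proof. exact: (@tpurer_linear _ _ N (coinv_lregular A)). Qed.
Lemma ind_in_bal n (b : B) a : ind_in (n <@ b) a = ind_in n (\val b * a).
Proof. exact: (@tpure_bal _ _ N (coinv_lregular A)). Qed.
Lemma ind_ind (P : ind_sort -> Prop) :
  P 0 -> (forall n a x, P x -> P (ind_in n a + x)) -> forall x, P x.
Proof. exact: (@tensor_ind _ _ N (coinv_lregular A)). Qed.

Section IndLift.
Variables (V : lmodType k) (f : N -> A -> V).
Variables (fl : forall a, linear (f^~ a)) (fr : forall n, linear (f n))
  (fb : forall n (b : B) a, f (n <@ b) a = f n (\val b * a)).

Fact ind_lift_subproof : @balanced k B N (coinv_lregular A) V f.
Proof. by split. Qed.
Definition ind_lift : ind_sort -> V := tlift ind_lift_subproof.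
HB.instance Definition _ :=
  GRing.Linear.copy ind_lift (tlift ind_lift_subproof).
Lemma ind_liftE n a : ind_lift (ind_in n a) = f n a.
Proof. exact: tliftE. Qed.
End IndLift.
Arguments ind_lift : simpl never.

Section Act.
Variable a : A.
Definition ind_act_fun (n : N) (a' : A) : ind_sort := ind_in n (a' * a).
Fact ind_act_linl a' : linear (ind_act_fun^~ a').
Proof. exact: ind_in_linearl. Qed.
Fact ind_act_linr n : linear (ind_act_fun n).
Proof. by move=> c u v; rewrite /ind_act_fun mulrDl -scalerAl linearP. Qed.
Fact ind_act_bal n (b : B) a' :
  ind_act_fun (n <@ b) a' = ind_act_fun n (\val b * a').
Proof. by rewrite /ind_act_fun ind_in_bal mulrA. Qed.
Definition ind_actr : ind_sort -> ind_sort :=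
  ind_lift ind_act_linl ind_act_linr ind_act_bal.
HB.instance Definition _ := GRing.Linear.copy ind_actr
  (ind_lift ind_act_linl ind_act_linr ind_act_bal).
Lemma ind_actrE n a' : ind_actr (ind_in n a') = ind_in n (a' * a).
Proof. exact: ind_liftE. Qed.
End Act.
Arguments ind_actr : simpl never.

Fact ind_actP : is_right_action (fun (x : ind_sort) a => ind_actr a x).
Proof.
split=> [a|x|x a a'|x]; first exact: linearP.
- move=> c u v /=; elim/ind_ind: x => [|n a x IH].
    by rewrite !linear0 ?scaler0 addr0.
  rewrite !linearD /= IH !ind_actrE mulrDr -scalerAr linearP ?scalerDr -!addrA.
  by congr (_ + _); rewrite addrCA.
- elim/ind_ind: x => [|n b x IH]; first by rewrite !linear0.
  by rewrite !linearD /= IH !ind_actrE mulrA.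
- elim/ind_ind: x => [|n b x IH]; first by rewrite !linear0.
  by rewrite !linearD /= IH !ind_actrE mulr1.
Qed.
Definition ind_rmod : rmodule A := RModule ind_actP.

Definition ind_coact_fun (n : N) (a : A) : ind_sort \ox H :=
  tmap (ind_in n) idfun (ca_coact A a).
Fact ind_coact_linl a : linear (ind_coact_fun^~ a).
Proof.
rewrite /ind_coact_fun => c u v.
elim/tensor_ind: (ca_coact A a) => [|a' h x IH].
  by rewrite !linear0 ?scaler0 addr0.
rewrite !linearD /= IH !tmapE /= ind_in_linearl.
rewrite (@tpureDl _ _ (rspace ind_sort) (lspace H)).
rewrite (@tpureZl _ _ (rspace ind_sort) (lspace H)) ?scalerDr -!addrA.
by congr (_ + _); rewrite addrCA.
Qed.
Fact ind_coact_linr n : linear (ind_coact_fun n).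
Proof. by move=> c u v; rewrite /ind_coact_fun !linearP. Qed.
Fact ind_coact_bal n (b : B) a :
  ind_coact_fun (n <@ b) a = ind_coact_fun n (\val b * a).
Proof.
rewrite /ind_coact_fun rmorphM /=; case: b => b bP /=; have /coinvP -> := bP.
elim/tensor_ind: (ca_coact A a) => [|a' h x IH].
  by rewrite mulr0 !linear0.
rewrite mulrDr !linearD /= IH [_ * (_ *t _)](tmulE b 1 a' h) !tmapE /= mul1r.
by rewrite ind_in_bal.
Qed.
(* ind_coact (n (x)_B a) = n (x)_B a_(0) (x) a_(1) *)
Definition ind_coact : ind_sort -> ind_sort \ox H :=
  ind_lift ind_coact_linl ind_coact_linr ind_coact_bal.
HB.instance Definition _ := GRing.Linear.copy ind_coact
  (ind_lift ind_coact_linl ind_coact_linr ind_coact_bal).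
Lemma ind_coactE n a :
  ind_coact (ind_in n a) = tmap (ind_in n) idfun (ca_coact A a).
Proof. exact: ind_liftE. Qed.
Arguments ind_coact : simpl never.

Fact ind_coactP : @is_hopf_module ind_rmod ind_coact.
Proof.
split; [split|] => x; last move=> a.
all: elim/ind_ind: x => [|n a' x IH]; first by rewrite ?ract0l !linear0 ?tact0l.
- rewrite !linearD /= IH !ind_coactE; congr (_ + _).
  have [/(_ a') coass _] := ca_coactP A.
  have h1 (y : A \ox H) : tmap ind_coact idfun (tmap (ind_in n) idfun y) =
    tmap (tmap (ind_in n) idfun) idfun (tmap (ca_coact A) idfun y).
    elim/tensor_ind: y => [|b h y IHy]; first by rewrite !linear0.
    by rewrite !linearD /= IHy !tmapE /= ind_coactE.
  have h2 (y : A \ox H) :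
    tmap idfun (hopf_comul H) (tmap (ind_in n) idfun y) =
    tmap (ind_in n) idfun (tmap idfun (hopf_comul H) y).
    elim/tensor_ind: y => [|b h y IHy]; first by rewrite !linear0.
    by rewrite !linearD /= IHy !tmapE.
  by rewrite h1 tassoc_tmap coass h2.
- rewrite !linearD /= IH ind_coactE tcontrr_tmap.
  by have [_ ->] := ca_coactP A.
- rewrite ractDl !linearD /= IH tactDl; congr (_ + _).
  rewrite ind_actrE !ind_coactE rmorphM /=.
  rewrite (@tact_tmap _ _ _ (rregular A) ind_rmod (rregular H)) //.
  by move=> u v; rewrite [RHS]ind_actrE.
Qed.
Definition ind_hopf : hopfModule := HopfModule ind_coactP.

End Induced.
End HopfModules.

Arguments ind_ind : clear implicits.

Record fodc (k : fieldType) (R : algType k) := Fodc {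
  fodc_sort :> bimodule R;
  fodc_d : {linear R -> fodc_sort};
  fodc_leibniz : forall a b,
    fodc_d (a * b) = fodc_d a <@ b + a @> fodc_d b }.

Definition hom_connection (k : fieldType) (R : algType k) (W : fodc R)
    (M : rmodule R) (nabla : rhom W M -> M) : Prop :=
  linear nabla /\
  forall (f : rhom W M) (a : R),
    nabla (hom_act f a) = nabla f <@ a + f (fodc_d W a).

Section CoinvCalculus.
Context {k : fieldType} {H : hopfAlgebra k} (A : comodAlgebra H).
Local Notation B := (coinvAlg A).

(* Colinearity of the left action is only required for B, not for all of A. *)
Record covariantCalculus := CovariantCalculus {
  cc_sort :> fodc A;
  cc_coact : {linear cc_sort -> cc_sort \ox H};
  cc_coactP : is_hopf_module cc_coact;
  cc_d_colinear : right_colinear (ca_coact A) cc_coact (fodc_d cc_sort);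
  cc_left_colinear : forall b : B,
    right_colinear cc_coact cc_coact (@bactl _ _ cc_sort (\val b)) }.

Section CalculusB.
Variable W : fodc A.

(* membership in the B-sub-bimodule of W generated by d(B) *)
Inductive omegaB_gen : W -> Prop :=
| OmegaB_d (b : B) : omegaB_gen (fodc_d W (\val b))
| OmegaB_0 : omegaB_gen 0
| OmegaB_D w w' : omegaB_gen w -> omegaB_gen w' -> omegaB_gen (w + w')
| OmegaB_Z (c : k) w : omegaB_gen w -> omegaB_gen (c *: w)
| OmegaB_l (b : B) w : omegaB_gen w -> omegaB_gen (\val b @> w)
| OmegaB_r w (b : B) : omegaB_gen w -> omegaB_gen (w <@ \val b).

Definition omegaB_pred : {pred W} := fun w => `[< omegaB_gen w >].

Lemma omegaB_predP w : reflect (omegaB_gen w) (w \in omegaB_pred).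
Proof. exact: asboolP. Qed.

Fact omegaB_closed : submod_closed omegaB_pred.
Proof.
split=> [|c u v /omegaB_predP uP /omegaB_predP vP]; apply/omegaB_predP.
  exact: OmegaB_0.
by apply: OmegaB_D => //; exact: OmegaB_Z.
Qed.

Record omegaB_sort := OmegaB {
  om_val :> W;
  om_valP : om_val \in omegaB_pred }.

HB.instance Definition _ := [isSub for om_val].
HB.instance Definition _ := [Choice of omegaB_sort by <:].
HB.instance Definition _ :=
  GRing.SubChoice_isSubLmodule.Build k W _ omegaB_sort omegaB_closed.

Lemma om_valD c (u v : omegaB_sort) :
  om_val (c *: u + v) = c *: om_val u + om_val v.
Proof. by []. Qed.

Fact omegaB_r_subproof (w : omegaB_sort) (b : B) :
  \val w <@ \val b \in omegaB_pred.
Proof. by apply/omegaB_predP/OmegaB_r/omegaB_predP/om_valP. Qed.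
Definition omegaB_r w b : omegaB_sort := OmegaB (omegaB_r_subproof w b).

Fact omegaB_l_subproof (b : B) (w : omegaB_sort) :
  \val b @> \val w \in omegaB_pred.
Proof. by apply/omegaB_predP/OmegaB_l/omegaB_predP/om_valP. Qed.
Definition omegaB_l b w : omegaB_sort := OmegaB (omegaB_l_subproof b w).

Fact omegaB_d_subproof (b : B) : fodc_d W (\val b) \in omegaB_pred.
Proof. exact/omegaB_predP/OmegaB_d. Qed.
Definition omegaB_d b : omegaB_sort := OmegaB (omegaB_d_subproof b).

Fact omegaB_rP : is_right_action omegaB_r.
Proof.
split=> [b|m|m b c|m]; [move=> c u v|move=> c u v| |]; apply: val_inj => /=.
- by rewrite ?om_valD ractDl ractZl.
- by rewrite ?ba_valD linearP.
- by rewrite ?ba_valM ractM.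
- by rewrite ?ba_val1 ract1.
Qed.
Fact omegaB_lP : is_left_action omegaB_l.
Proof.
split=> [b|m|b c m|m]; [move=> c u v|move=> c u v| |]; apply: val_inj => /=.
- by rewrite ?om_valD bactDr bactZr.
- by rewrite ?ba_valD bactDl bactZl.
- by rewrite ?ba_valM bactM.
- by rewrite ?ba_val1 bact1.
Qed.
Fact omegaB_A b m c : omegaB_r (omegaB_l b m) c = omegaB_l b (omegaB_r m c).
Proof. by apply: val_inj; rewrite /= bactA. Qed.

Fact omegaB_d_linear : linear omegaB_d.
Proof. by move=> c u v; apply: val_inj; rewrite /= ?ba_valD linearP. Qed.
HB.instance Definition _ :=
  GRing.isLinear.Build k B omegaB_sort *:%R omegaB_d omegaB_d_linear.

Definition omegaB_rmod : rmodule B := RModule omegaB_rP.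
Definition omegaB_bimod : bimodule B :=
  @Bimodule k B omegaB_rmod omegaB_l omegaB_lP omegaB_A.

Fact omegaB_leibniz b c :
  omegaB_d (b * c) = omegaB_r (omegaB_d b) c + omegaB_l b (omegaB_d c).
Proof. by apply: val_inj; rewrite /= ?ba_valM fodc_leibniz. Qed.

Definition omegaB : fodc B :=
  @Fodc k B omegaB_bimod omegaB_d omegaB_leibniz.

(* j : Omega^1(B) (x)_B A -> Omega^1(A), w (x)_B a |-> w a *)
Definition omegaB_j_fun (w : omegaB) (a : A) : W := om_val w <@ a.
Fact omegaB_j_linl a : linear (omegaB_j_fun^~ a).
Proof. by move=> c u v; rewrite /omegaB_j_fun om_valD ractDl ractZl. Qed.
Fact omegaB_j_linr w : linear (omegaB_j_fun w).
Proof. exact: ract_linear. Qed.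
Fact omegaB_j_bal w (b : B) a :
  omegaB_j_fun (w <@ b) a = omegaB_j_fun w (\val b * a).
Proof. by rewrite /omegaB_j_fun ractM. Qed.
Definition omegaB_j : ind_sort omegaB -> W :=
  ind_lift omegaB_j_linl omegaB_j_linr omegaB_j_bal.
Lemma omegaB_jE (w : omegaB) a : omegaB_j (ind_in w a) = om_val w <@ a.
Proof. exact: ind_liftE. Qed.

End CalculusB.

(* the left B-action on N (x)_B A of a B-bimodule N: b (n (x) a) = b n (x) a *)
Section IndLact.
Variables (N : bimodule B) (b : B).
Definition ind_lact_fun (n : N) (a : A) : ind_sort N := ind_in (b @> n) a.
Fact ind_lact_linl a : linear (ind_lact_fun^~ a).
Proof. by move=> c u v; rewrite /ind_lact_fun bactDr bactZr ind_in_linearl. Qed.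
Fact ind_lact_linr n : linear (ind_lact_fun n).
Proof. exact: ind_in_linear. Qed.
Fact ind_lact_bal n (c : B) a :
  ind_lact_fun (n <@ c) a = ind_lact_fun n (\val c * a).
Proof. by rewrite /ind_lact_fun -bactA ind_in_bal. Qed.
Definition ind_lact : ind_sort N -> ind_sort N :=
  ind_lift ind_lact_linl ind_lact_linr ind_lact_bal.
Lemma ind_lactE n a : ind_lact (ind_in n a) = ind_in (b @> n) a.
Proof. exact: ind_liftE. Qed.
End IndLact.

(* fhat (n (x)_B a) = f n a *)
Section Hat.
Variables (N : rmodule B) (M : hopfModule A) (f : rhom N (coinvMod M)).
Definition hom_hat_fun (n : N) (a : A) : M := cm_val (f n) <@ a.
Fact hom_hat_linl a : linear (hom_hat_fun^~ a).
Proof. by move=> c u v; rewrite /hom_hat_fun linearP cm_valD ractDl ractZl. Qed.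
Fact hom_hat_linr n : linear (hom_hat_fun n).
Proof. exact: ract_linear. Qed.
Fact hom_hat_bal n (b : B) a :
  hom_hat_fun (n <@ b) a = hom_hat_fun n (\val b * a).
Proof. by rewrite /hom_hat_fun rhom_ract ractM. Qed.
Definition hom_hat_map : ind_sort N -> M :=
  ind_lift hom_hat_linl hom_hat_linr hom_hat_bal.
Fact hom_hat_subproof : hom_hat_map \in right_linear (ind_rmod N) M.
Proof.
apply/right_linearP; split=> [|x a]; first exact: linearP.
have hatD u v : hom_hat_map (u + v) = hom_hat_map u + hom_hat_map v.
  exact: linearD.
have hatE n (b : A) : hom_hat_map (ind_in n b) = hom_hat_fun n b.
  exact: ind_liftE.
elim/ind_ind: x => [|n a' x IH].
  by rewrite ract0l [hom_hat_map 0]linear0 ract0l.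
rewrite ractDl !hatD ractDl IH; congr (_ + _).
have -> : @ract _ _ (ind_rmod N) (ind_in n a') a = ind_in n (a' * a).
  exact: ind_actrE.
by rewrite !hatE /hom_hat_fun ractM.
Qed.
Definition hom_hat : rhom (ind_rmod N) M := RHom hom_hat_subproof.
Lemma hom_hatE n a : hom_hat (ind_in n a) = cm_val (f n) <@ a.
Proof. exact: ind_liftE. Qed.
End Hat.

End CoinvCalculus.

(* Main.v *)
Require Import Defs.
From HB Require Import structures.
From mathcomp Require Import all_boot all_order all_algebra.
From mathcomp Require Import boolp.

Set Implicit Arguments.
Unset Strict Implicit.
Unset Printing Implicit Defensive.

Import GRing.Theory.
Local Open Scope ring_scope.

(** The correspondence [f |-> rcomp (hom_hat f) Pi] turns a right B-linear map
    on the calculus of B into a right A-linear map on the calculus of A.  It is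
    compatible with everything that a hom-connection sees:

    - [hom_hat f] is colinear, because [f] takes coinvariant values
      ([hom_hat_colinear]).  Hence [rcomp (hom_hat f) Pi] is colinear, and the
      hypothesis on [nabla] makes its value there coinvariant: the induced map
      exists.
    - the correspondence is k-linear, and it intertwines the actions of B
      because [Pi] is left B-linear ([hom_hat_act]).
    - it extends [f]: as [Pi] splits [j], it sends [w] in the calculus of B to
      the tensor of [w] and [1], on which [hom_hat f] is [f w].  Applied to
      [w = d b], this identifies the inhomogeneous term in the Leibniz rule.

    The Leibniz rule of [nabla] on [rcomp (hom_hat f) Pi], restricted to scalars
    in B, is therefore that of the induced map. *)

Section HomHat.
Context {k : fieldType} {H : hopfAlgebra k} {A : comodAlgebra H}.
Local Notation B := (coinvAlg A).

Lemma rhom_ext (R : algType k) (M N : rmodule R) (f g : rhom M N) :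
  f =1 g -> f = g.
Proof. by move=> fg; apply: val_inj; apply: funext. Qed.

Lemma rhomD (R : algType k) (M N : rmodule R) (f : rhom M N) :
  {morph f : x y / x + y}.
Proof. exact: linearD. Qed.

Lemma rhom0 (R : algType k) (M N : rmodule R) (f : rhom M N) : f 0 = 0.
Proof. exact: linear0. Qed.

Lemma right_colinear_comp (U V W : lmodType k) (rhoU : U -> U \ox H)
    (rhoV : V -> V \ox H) (rhoW : W -> W \ox H)
    (g : {linear V -> W}) (f : {linear U -> V}) :
  right_colinear rhoU rhoV f -> right_colinear rhoV rhoW g ->
  right_colinear rhoU rhoW (g \o f).
Proof. by move=> fC gC u; rewrite /= gC fC tmap_tmap. Qed.

Section Hat.
Variable M : hopfModule A.

(** Since [f n] is coinvariant, compatibility of action and coaction makes the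
    coaction of M at [f n <@ a] the product of [f n *t 1] with the coaction of
    [a], so only [a] contributes, just as for the coaction on the induced
    module. *)
Lemma hom_hat_colinear (N : rmodule B) (f : rhom N (coinvMod M)) :
  right_colinear (hm_coact (ind_hopf N)) (hm_coact M) (hom_hat f).
Proof.
move=> x; rewrite -[LHS]/(hm_coact M (hom_hat f x)).
elim/ind_ind: x => [|n a x IH]; first by rewrite rhom0 !linear0.
have coactE : hm_coact (ind_hopf N) (ind_in n a) =
    tmap (ind_in n) idfun (ca_coact A a) by exact: ind_coactE.
rewrite rhomD !linearD IH hom_hatE coactE.
congr (_ + _) => {x IH}; have [_ ->] := hm_coactP M.
have /coinvP -> := cm_valP (f n).
elim/tensor_ind: (ca_coact A a) => [|b h y IH]; first by rewrite !linear0.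
rewrite !linearD /= IH !tmapE (@tactE _ _ _ M (rregular H)).
congr (_ *t _ + _); first by rewrite -hom_hatE.
exact: mul1r.
Qed.

Lemma hom_hat_linear (N : rmodule B) (c : k) (f g : rhom N (coinvMod M)) x :
  hom_hat (c *: f + g) x = c *: hom_hat f x + hom_hat g x.
Proof.
elim/ind_ind: x => [|n a x IH]; first by rewrite !rhom0 scaler0 addr0.
rewrite !rhomD IH !hom_hatE cm_valD ractDl ractZl scalerDr -!addrA.
by congr (_ + _); rewrite addrCA.
Qed.

(** The action of B on maps transposes the left action on the first tensor
    factor: both sides send the tensor of [n] and [a] to [f (b @> n) <@ a]. *)
Lemma hom_hat_act (N : bimodule B) (f : rhom N (coinvMod M)) (b : B) x :
  hom_hat (hom_act f b) x = hom_hat f (ind_lact b x).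
Proof.
have lactD u v : ind_lact b (u + v) = ind_lact b u + ind_lact b v.
  exact: linearD.
have lact0 : ind_lact b (0 : ind_sort N) = 0 by exact: linear0.
elim/ind_ind: x => [|n a x IH]; first by rewrite lact0 !rhom0.
by rewrite lactD !rhomD IH ind_lactE !hom_hatE.
Qed.

End Hat.
End HomHat.

Theorem theorem4p3 (k : fieldType) (H : hopfAlgebra k) (A : comodAlgebra H)
  (A_galois : hopf_galois A)
  (A_flat : faithfully_flat (coinv_lregular A))
  (W : covariantCalculus A)
  (Pi : rhom W (ind_hopf (omegaB W)))
  (Pi_colinear : right_colinear (cc_coact W) (hm_coact (ind_hopf (omegaB W))) Pi)
  (Pi_left_linear : forall (b : coinvAlg A) (w : W),
     Pi (\val b @> w) = ind_lact b (Pi w))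
  (Pi_j : forall x : ind_sort (omegaB W), Pi (omegaB_j x) = x)
  (M : hopfModule A)
  (nabla : rhom W M -> M)
  (nabla_hom : hom_connection nabla)
  (nabla_coinv : forall f : rhom W M,
     right_colinear (cc_coact W) (hm_coact M) f ->
     nabla f \in coinv (hm_coact M)) :
  exists nabla_coH : rhom (omegaB W) (coinvMod M) -> coinvMod M,
    (forall f, cm_val (nabla_coH f) = nabla (rcomp (hom_hat f) Pi)) /\
    hom_connection nabla_coH.
Proof.
have hat_coinv f : nabla (rcomp (hom_hat f) Pi) \in coinv (hm_coact M).
  apply: nabla_coinv.
  exact: (right_colinear_comp Pi_colinear (hom_hat_colinear f)).
have [nabla_lin nabla_leibniz] := nabla_hom.
exists (fun f => CoinvMod (hat_coinv f)); split=> //; split=> [c f g|f b].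
  apply: val_inj => /=; rewrite -nabla_lin; congr nabla.
  by apply: rhom_ext => w; exact: hom_hat_linear.
have hat_act : rcomp (hom_hat (hom_act f b)) Pi
             = hom_act (rcomp (hom_hat f) Pi) (\val b).
  by apply: rhom_ext => w; rewrite [LHS]hom_hat_act -Pi_left_linear.
(* d b is the image under j of the tensor of d b and 1, hence fixed by Pi. *)
have Pi_d : Pi (fodc_d W (\val b)) = ind_in (fodc_d (omegaB W) b) 1.
  by rewrite -[RHS]Pi_j omegaB_jE ract1.
apply: val_inj; rewrite /= hat_act nabla_leibniz; congr (_ + _).
by rewrite -[LHS]/(hom_hat f (Pi _)) Pi_d hom_hatE ract1.
Qed.
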